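(* Let $G$ be an $n$-vertex graph obtained from the graph consisting of two vertices joined by three parallel edges by repeatedly (zero or more times) expanding a vertex to a triangle. Then $G$ has exactly $2^{n/2-1}$ circuit double covers.
   Context: Graphs are finite and may have parallel edges. Expanding a vertex $v$ of degree 3 (incident with edges $e_1,e_2,e_3$) to a triangle means replacing $v$ by three pairwise adjacent new vertices $v_1,v_2,v_3$ and making $e_i$ incident with $v_i$ instead of $v$, for $i=1,2,3$. A circuit is a connected 2-regular subgraph (a subgraph isomorphic to $C_k$ for some $k$; two parallel edges form a circuit $C_2$). A circuit double cover of a graph $G$ is a multiset of circuits of $G$ such that every edge of $G$ is contained in exactly two elements of the multiset (counted with multiplicity). *)

(* Defs.v *)
(* MathComp world *)
From mathcomp Require Import all_boot.
From mathcomp Require Import finmap multiset.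

Set Implicit Arguments.
Unset Strict Implicit.
Unset Printing Implicit Defensive.

Local Open Scope mset_scope.

(* Finite loopless multigraphs: distinct edges may have the same set of ends. *)
Record mgraph := MGraph {
  vertex : finType;
  edge : finType;
  ends : edge -> {set vertex};
  card_ends : forall f, #|ends f| = 2 }.

Arguments ends {m}.

Definition isomorphic (G H : mgraph) : Prop :=
  exists (phi : vertex G -> vertex H) (psi : edge G -> edge H),
    [/\ bijective phi, bijective psi &
        forall f, ends (psi f) = phi @: ends f].

Section Expansion.

Variables (G : mgraph) (v : vertex G) (e : 'I_3 -> edge G).

(* The vertex [inr i] is v_i; the edge [inr i] is the edge of the new triangle
   that joins the two new vertices other than v_i. *)
Definition expand_ends (f : edge G + 'I_3) :
    {set {w : vertex G | w != v} + 'I_3} :=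
  match f with
  | inl f => [set inl w | w : {w : vertex G | w != v} & val w \in ends f]
             :|: [set inr i | i : 'I_3 & e i == f]
  | inr i => [set inr j | j : 'I_3 & j != i]
  end.

Hypothesis e_inj : injective e.
Hypothesis e_inc : forall f, (v \in ends f) = (f \in codom e).

Lemma card_expand_ends f : #|expand_ends f| = 2.
Proof.
case: f => [f|i] /=; last first.
  rewrite card_imset; last by move=> ? ? [].
  have -> : #|[set j : 'I_3 | j != i]| = #|predC1 i|.
    by apply: eq_card => j; rewrite !inE.
  by rewrite cardC1 card_ord.
rewrite cardsU disjoint_setI0 ?cards0 ?subn0; last first.
  apply/pred0P => -[w|i] /=; apply/andP => -[].
    by move=> _ /imsetP[].
  by move=> /imsetP[].
rewrite !card_imset; try by move=> ? ? [].
have -> : #|[set w : {w : vertex G | w != v} | val w \in ends f]|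
           = #|ends f :\ v|.
  rewrite -(card_imset _ val_inj); apply: eq_card => w; rewrite !inE.
  apply/imsetP/andP => [[u]|[wv wf]].
    by rewrite inE => uf ->; rewrite (valP u).
  by exists (exist _ w wv); rewrite ?inE.
have -> : #|[set i : 'I_3 | e i == f]| = (v \in ends f).
  rewrite e_inc; case: (boolP (f \in codom e)) => [/codomP[i ->]|fNe].
    by apply/eqP/cards1P; exists i; apply/setP => j; rewrite !inE (inj_eq e_inj).
  apply: eq_card0 => j; rewrite inE; apply: contraNF fNe => /eqP <-.
  exact: codom_f.
by rewrite addnC -cardsD1 card_ends.
Qed.

Definition expand : mgraph := MGraph card_expand_ends.

End Expansion.

Definition theta_ends (f : 'I_3) : {set 'I_2} := [set: 'I_2].

Lemma card_theta_ends f : #|theta_ends f| = 2.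
Proof. by rewrite cardsT card_ord. Qed.

Definition theta : mgraph := MGraph card_theta_ends.

(* [e] lists e_1, e_2, e_3: the hypotheses on it say that v has degree 3 and
   that these are the edges incident with v. *)
Inductive theta_expansion : mgraph -> Prop :=
| ThetaExpansion0 : theta_expansion theta
| ThetaExpansionS (G : mgraph) (v : vertex G) (e : 'I_3 -> edge G)
    (e_inj : injective e) (e_inc : forall f, (v \in ends f) = (f \in codom e)) :
    theta_expansion G -> theta_expansion (expand e_inj e_inc)
| ThetaExpansion_iso (G H : mgraph) :
    isomorphic G H -> theta_expansion G -> theta_expansion H.

Section Circuits.

Variable G : mgraph.

(* A subgraph is given by its vertex set and its edge set. *)
Definition is_subgraph (S : {set vertex G} * {set edge G}) : bool :=
  [forall f in S.2, ends f \subset S.1].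

Definition sub_degree (S : {set vertex G} * {set edge G}) (x : vertex G) : nat :=
  #|[set f in S.2 | x \in ends f]|.

Definition sub_adj (S : {set vertex G} * {set edge G}) : rel (vertex G) :=
  fun x y => [exists f in S.2, ends f == [set x; y]].

Definition sub_connected (S : {set vertex G} * {set edge G}) : bool :=
  (S.1 != set0) &&
  [forall x in S.1, forall y in S.1, connect (sub_adj S) x y].

Definition is_circuit (S : {set vertex G} * {set edge G}) : bool :=
  [&& is_subgraph S, sub_connected S & [forall x in S.1, sub_degree S x == 2]].

Definition circuit : finType :=
  {S : {set vertex G} * {set edge G} | is_circuit S}.

Definition circuit_edges (C : circuit) : {set edge G} := (val C).2.

(* [M C] is the multiplicity of C in M. *)
Definition is_circuit_double_cover (M : {mset circuit}) : Prop :=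
  forall f : edge G, \sum_(C : circuit | f \in circuit_edges C) M C = 2.

End Circuits.

(* Main.v *)
(* A circuit is determined by its edge set, and the edge sets of circuits are the
   minimal nonempty edge sets with all degrees in {0, 2}.  At a vertex v of degree 3
   every circuit double cover uses each of the three pairs of edges exactly once.
   Replace v by a triangle.  A circuit through v, using two edges e_i and e_j, can
   be rerouted along the edge v_i v_j or along the path v_i v_k v_j, and the only
   other new circuit is the triangle.  Counting the circuits through the triangle
   edges shows that the three circuits through v are either all rerouted along one
   edge, and the triangle is taken once, or all rerouted along two edges, and the
   triangle is not taken.  So each expansion doubles the number of circuit double
   covers, starting from the only one of the two-vertex graph. *)
Require Import Defs.
From mathcomp Require Import all_boot.
From mathcomp Require Import finmap multiset.
From mathcomp Require Import zify.

Set Implicit Arguments.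
Unset Strict Implicit.
Unset Printing Implicit Defensive.

Local Open Scope mset_scope.

(** * Circuits as minimal nonempty two-regular edge sets *)

Section CircuitEdgeSets.

Variable G : mgraph.
Implicit Types (x y : vertex G) (f : edge G) (F D : {set edge G}).

Definition degree F x := #|[set f in F | x \in ends f]|.

Definition two_regular F := [forall x, (degree F x == 0) || (degree F x == 2)].

Definition circuit_set := minset (fun F => (F != set0) && two_regular F).

Definition covered F := [set x | degree F x != 0].

Lemma degree_neq0 F x : reflect (exists2 f, f \in F & x \in ends f) (degree F x != 0).
Proof.
rewrite cards_eq0; apply: (iffP (set0Pn _)) => [[f]|[f fF xf]].
  by rewrite inE => /andP[]; exists f.
by exists f; rewrite inE fF.
Qed.

Lemma ends_has f : exists x, x \in ends f.
Proof. by apply/set0Pn; rewrite -cards_eq0 card_ends. Qed.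

Lemma ends_eq f x y : x \in ends f -> y \in ends f -> x != y -> ends f = [set x; y].
Proof.
move=> xf yf xy; apply/esym/eqP; rewrite eqEcard card_ends cards2 xy andbT.
by apply/subsetP => z; rewrite !inE => /orP[] /eqP ->.
Qed.

Lemma two_regular_degree F x : two_regular F -> degree F x != 0 -> degree F x = 2.
Proof. by move=> /forallP /(_ x) /orP[/eqP->|/eqP->]. Qed.

(** At a vertex that [B] meets, both degrees are 2, so the inclusion is an equality: [B] cannot
    leave out any edge of [F] there. *)
Lemma two_regular_sub (B F : {set edge G}) x :
  B \subset F -> two_regular B -> two_regular F ->
  degree B x != 0 -> [set f in B | x \in ends f] = [set f in F | x \in ends f].
Proof.
move=> BF rB rF dB.
have sub : [set f in B | x \in ends f] \subset [set f in F | x \in ends f].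
  by apply/subsetP => f; rewrite !inE => /andP[/(subsetP BF) -> ->].
apply/eqP; rewrite eqEcard sub /= -/(degree B x) -/(degree F x).
rewrite (two_regular_degree rB dB) two_regular_degree //.
rewrite -lt0n (leq_trans _ (subset_leq_card sub)) // lt0n; exact: dB.
Qed.

Lemma sub_adj_sym S : connect_sym (@sub_adj G S).
Proof. by apply: sym_connect_sym => x y; apply: eq_existsb => f; rewrite setUC. Qed.

Lemma circuit_covered S : is_circuit S -> S.1 = covered S.2.
Proof.
case: S => V F /and3P[/forall_inP /= sub _ /forall_inP /= deg].
apply/setP => x; rewrite inE; apply/idP/idP.
  by move=> /deg; rewrite /sub_degree /degree => /eqP /= ->.
by move=> /degree_neq0[f /sub /subsetP fV /fV].
Qed.

Lemma circuit_edge_set S : is_circuit S -> circuit_set S.2.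
Proof.
move=> SC; have := circuit_covered SC; move: SC; case: S => V F SC /= VE.
have /and3P[/forall_inP /= sub /andP[V0 /forall_inP /= conn] /forall_inP /= deg] := SC.
have rF : two_regular F.
  apply/forallP => x; have [->|/= d0] := eqVneq (degree F x) 0 => //=.
  by apply: deg; rewrite VE inE.
apply/minsetP; split.
  rewrite rF andbT; have /set0Pn[x] := V0; rewrite VE inE => /degree_neq0[f fF _].
  by apply/set0Pn; exists f.
move=> B /andP[/set0Pn[f0 f0B] rB] BF; apply/eqP; rewrite eqEsubset BF.
apply/subsetP => f fF; have [x xf] := ends_has f; have [y yf0] := ends_has f0.
have yV : y \in V by apply: (subsetP (sub _ (subsetP BF _ f0B))).
have xV : x \in V by apply: (subsetP (sub _ fF)).
have /forall_inP /(_ x xV) cyx := conn y yV.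
(* By [two_regular_sub], [B] has all edges of [F] at each vertex it meets, so no edge of [F] leaves
   the vertices covered by [B]; connectedness then spreads [B] over all of [F]. *)
have cl : closed (sub_adj (V, F)) (covered B).
  apply: (intro_closed (sub_adj_sym _)) => u w /exists_inP[g /= gF /eqP gE].
  rewrite !inE => du; have : g \in [set f in F | u \in ends f].
    by rewrite inE gF gE !inE eqxx.
  rewrite -(two_regular_sub BF) // inE => /andP[gB _].
  by apply/degree_neq0; exists g => //; rewrite gE !inE eqxx orbT.
have := closed_connect cl cyx.
rewrite !inE => eqd; have dx : degree B x != 0.
  by rewrite -eqd; apply/degree_neq0; exists f0.
have : f \in [set f in F | x \in ends f] by rewrite inE fF.
by rewrite -(two_regular_sub BF) // inE => /andP[].
Qed.

Lemma circuit_set_circuit F : circuit_set F -> is_circuit (covered F, F).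
Proof.
move=> /minsetP[/andP[/set0Pn[f0 f0F] rF] minF].
have sub f x : f \in F -> x \in ends f -> x \in covered F.
  by move=> fF xf; rewrite inE; apply/degree_neq0; exists f.
apply/and3P; split.
- by apply/forall_inP => f /= fF; apply/subsetP => x; apply: sub.
- apply/andP; split => /=.
    by have [x xf] := ends_has f0; apply/set0Pn; exists x; apply: (sub f0).
  apply/forall_inP => x xV; apply/forall_inP => y yV.
  set c := connect (sub_adj (covered F, F)).
  (* The edges of the component of [x]: at each vertex their degree is that of [F] or 0, so
     minimality makes them all of [F]. *)
  pose B := [set f in F | [exists z in ends f, c x z]].
  have cP f z : f \in B -> z \in ends f -> c x z.
    rewrite inE => /andP[fF /exists_inP[w wf xw]] zf.
    have [<-//|wz] := eqVneq w z; apply: (connect_trans xw); apply: connect1.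
    by apply/exists_inP; exists f => //; rewrite (ends_eq wf zf wz).
  have BE f z : z \in ends f -> (f \in B) = (f \in F) && c x z.
    move=> zf; apply/idP/andP => [fB|[fF xz]].
      by split; [move: fB; rewrite inE => /andP[] | apply: cP fB zf].
    by rewrite inE fF; apply/exists_inP; exists z.
  have sBF : B \subset F by apply/subsetP => f; rewrite inE => /andP[].
  clearbody B; have BF : B = F.
    apply: minF => //; apply/andP; split.
      move: xV; rewrite inE => /degree_neq0[f fF xf]; apply/set0Pn; exists f.
      by rewrite (BE f x) // fF; apply: connect0.
    apply/forallP => z; have -> : degree B z = if c x z then degree F z else 0.
      rewrite /degree; case: ifP => xz.
        apply: eq_card => f; rewrite !inE.
        by case zf: (z \in ends f); rewrite ?andbF // (BE f z) // xz !andbT.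
      apply: eq_card0 => f; rewrite inE; case zf: (z \in ends f); rewrite ?andbF //.
      by rewrite (BE f z) // xz andbF.
    by case: ifP => // _; apply: (forallP rF).
  by move: yV; rewrite inE => /degree_neq0[f]; rewrite -BF => fB; apply: cP.
- apply/forall_inP => x /=; rewrite inE => dx; apply/eqP.
  exact: two_regular_degree rF dx.
Qed.

End CircuitEdgeSets.

(** * Double covers as multiplicity functions on edge sets *)

Section DoubleCovers.

Variable G : mgraph.

(* [N F] is the multiplicity of the circuit with edge set F. *)
Definition double_cover (N : {ffun {set edge G} -> nat}) : Prop :=
  (forall F, N F != 0 -> circuit_set F) /\
  (forall f, \sum_(F : {set edge G}) (f \in F) * N F = 2).

(** Functions into [nat] do not form a finite type, so the number is given by a duplicate-free
    exhaustive list. *)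
Definition num_double_covers k := exists s : seq {ffun {set edge G} -> nat},
  [/\ uniq s, size s = k & forall N, N \in s <-> double_cover N].

Lemma circuit_set_neq0 (F : {set edge G}) : circuit_set F -> F != set0.
Proof. by case/minsetP => /andP[]. Qed.

Lemma circuit_set_two_regular (F : {set edge G}) : circuit_set F -> two_regular F.
Proof. by case/minsetP => /andP[]. Qed.

Lemma double_cover_neq0 N F : double_cover N -> N F != 0 -> F != set0.
Proof. by case=> supp _ /supp /circuit_set_neq0. Qed.

Lemma double_cover0 N : double_cover N -> N set0 = 0.
Proof. by move=> cN; apply/eqP/negPn/negP => /(double_cover_neq0 cN); rewrite eqxx. Qed.

End DoubleCovers.

(** * Incidences and degrees in the expanded graph *)

Section Expansion.

Variables (G : mgraph) (v : vertex G) (e : 'I_3 -> edge G).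
Hypotheses (e_inj : injective e) (e_inc : forall f, (v \in ends f) = (f \in codom e)).

Let G' := expand e_inj e_inc.

Implicit Types (D : {set edge G}) (X : {set edge G'}) (s t : bool).

Let i0 := @Ordinal 3 0 isT.
Let i1 := @Ordinal 3 1 isT.
Let i2 := @Ordinal 3 2 isT.

Lemma ord3P (P : 'I_3 -> Prop) : P i0 -> P i1 -> P i2 -> forall i, P i.
Proof.
move=> P0 P1 P2 [[|[|[|//]]] lt_i]; [move: P0 | move: P1 | move: P2];
  by congr P; apply: val_inj.
Qed.

Lemma sum_ord3 (h : 'I_3 -> nat) : \sum_i h i = h i0 + h i1 + h i2.
Proof.
rewrite !big_ord_recl big_ord0 addn0 addnA.
by congr (h _ + h _ + h _); apply: val_inj.
Qed.

Lemma degreeE (H : mgraph) (F : {set edge H}) x :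
  degree F x = \sum_f ((f \in F) && (x \in ends f)).
Proof.
by rewrite /degree -sum1_card big_mkcond; apply: eq_bigr => f _; rewrite inE; case: ifP.
Qed.

Lemma inl_ends_inl (w : {w | w != v}) (f : edge G) :
  (inl w \in expand_ends v e (inl f)) = (val w \in ends f).
Proof.
rewrite inE /=; apply/orP/idP => [[/imsetP[u]|/imsetP[//]]|wf].
  by rewrite inE => uf [->].
by left; apply/imsetP; exists w; rewrite ?inE.
Qed.

Lemma inl_ends_inr (w : {w | w != v}) i : inl w \in expand_ends v e (inr i) = false.
Proof. by apply/negbTE/negP => /imsetP[]. Qed.

Lemma inr_ends_inl i (f : edge G) : (inr i \in expand_ends v e (inl f)) = (e i == f).
Proof.
rewrite inE /=; apply/orP/idP => [[/imsetP[//]|/imsetP[j]]|ei].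
  by rewrite inE => ej [->].
by right; apply/imsetP; exists i; rewrite ?inE.
Qed.

Lemma inr_ends_inr i j : (inr i \in expand_ends v e (inr j)) = (i != j).
Proof.
apply/imsetP/idP => [[k]|ij]; first by rewrite inE => kj [->].
by exists i; rewrite ?inE.
Qed.

(** * Two-regular edge sets of the expanded graph *)

Definition old_edges X : {set edge G} := [set f | inl f \in X].

(** As [inr i] is opposite to v_i, the flag [s] chooses between the triangle edges opposite to the
    used [e i] and their complement in the triangle. *)
Definition lift_edges D s : {set edge G'} :=
  [set f : edge G + 'I_3 |
    match f with inl f => f \in D | inr i => (e i \in D) (+) s end].

Lemma inl_lift D s f : ((inl f : edge G') \in lift_edges D s) = (f \in D).
Proof. by rewrite inE. Qed.

Lemma inr_lift D s i : ((inr i : edge G') \in lift_edges D s) = (e i \in D) (+) s.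
Proof. by rewrite inE. Qed.

Lemma old_edges_lift D s : old_edges (lift_edges D s) = D.
Proof. by apply/setP => f; rewrite !inE. Qed.

Lemma lift_edges_inj D1 D2 s1 s2 :
  lift_edges D1 s1 = lift_edges D2 s2 -> D1 = D2 /\ s1 = s2.
Proof.
move=> eqL; have D12 : D1 = D2 by rewrite -(old_edges_lift D1 s1) eqL old_edges_lift.
split=> //; have := congr1 (fun X => (inr i0 : edge G') \in X) eqL.
by rewrite !inr_lift D12 {eqL}; case: (e i0 \in D2); case: s1; case: s2.
Qed.

Lemma degree_v D : degree D v = (e i0 \in D) + (e i1 \in D) + (e i2 \in D).
Proof.
have -> : degree D v = #|[set i | e i \in D]|.
  rewrite -(card_imset _ e_inj); apply: eq_card => f; rewrite inE e_inc.
  apply/andP/imsetP => [[fD /codomP[i fE]]|[i]].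
    by exists i; rewrite // inE -fE.
  by rewrite inE => eD ->; rewrite codom_f.
rewrite -sum1_card big_mkcond sum_ord3.
by rewrite !inE; do 3 case: (_ \in D).
Qed.

Lemma degree_inl X (w : {w | w != v}) :
  @degree G' X (inl w) = degree (old_edges X) (val w).
Proof.
rewrite !degreeE big_sumType /= [X in _ + X]big1 ?addn0 => [|i _].
  by apply: eq_bigr => f _; rewrite inl_ends_inl inE.
by rewrite inl_ends_inr andbF.
Qed.

Lemma degree_inr X i :
  @degree G' X (inr i) = ((inl (e i) : edge G') \in X) +
    \sum_(j < 3) (((inr j : edge G') \in X) && (i != j)).
Proof.
rewrite degreeE big_sumType /=; congr (_ + _).
  rewrite (bigD1 (e i)) //= inr_ends_inl eqxx andbT big1 ?addn0 // => f fi.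
  by rewrite inr_ends_inl eq_sym (negbTE fi) andbF.
by apply: eq_bigr => j _; rewrite inr_ends_inr.
Qed.

(** A degree at most 3 is 0 or 2 exactly when it is even, so parity keeps all the information at [v]
    in a form suited to boolean case analysis. *)
Lemma two_regular_v D : two_regular D ->
  (e i0 \in D) (+) (e i1 \in D) (+) (e i2 \in D) = false.
Proof. by move=> /forallP /(_ v); rewrite degree_v; do 3 case: (_ \in D). Qed.

Lemma two_regular_lift D s : two_regular D -> two_regular (lift_edges D s).
Proof.
move=> rD; have par := two_regular_v rD; apply/forallP => -[w|i].
  by rewrite degree_inl old_edges_lift; apply: (forallP rD).
move: i; apply: ord3P; rewrite degree_inr sum_ord3 !inr_lift inl_lift /=;
  by move: par; case: s; do 3 case: (_ \in D).
Qed.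

(* The degree of v_i is [[e_i used] + [t_j used] + [t_k used]], where t_j is the
   triangle edge opposite to v_j, so t_j and t_k agree iff e_i is unused: the set
   of all i with t_i used is that of all i with e_i used, or its complement. *)
Lemma two_regular_lifted X : two_regular X ->
  exists D s, X = lift_edges D s /\ two_regular D.
Proof.
move=> rX; exists (old_edges X), ((inl (e i0) \in X) (+) (inr i0 \in X)).
have par i := forallP rX (inr i).
(* The constraints at the three new vertices involve six memberships only, so the triangle edges and
   the degree at [v] are settled by a finite check. *)
have := (par i0, par i1, par i2).
rewrite !degree_inr !sum_ord3 /= => par3; split.
  apply/setP => -[f|]; first by rewrite !inE.
  apply: ord3P; rewrite inr_lift inE; move: par3;
    by do 6 case: (_ \in X) => //=; do ?case=> //.
apply/forallP => x; have [->|xv] := eqVneq x v; last first.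
  by have := forallP rX (inl (exist _ x xv)); rewrite degree_inl.
by rewrite degree_v !inE; move: par3; do 6 case: (_ \in X) => //=; do ?case=> //.
Qed.

(** * Circuits of the expanded graph *)

Definition touches D := [exists i, e i \in D].

(** For a two-regular [D], this says that [D] passes through [v] along the two edges other than
    [e i]. *)
Definition misses i D := touches D && (e i \notin D).

Lemma touchesE D : touches D = [|| e i0 \in D, e i1 \in D | e i2 \in D].
Proof.
apply/existsP/or3P => [[i]|[] eD]; try by eexists; exact: eD.
by move: i; apply: ord3P => eD; [apply: Or31 | apply: Or32 | apply: Or33].
Qed.

Lemma touches_misses D : two_regular D -> touches D -> exists i, misses i D.
Proof.
move=> /two_regular_v par tD; suff /or3P[] : [|| misses i0 D, misses i1 D | misses i2 D].
- by exists i0.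
- by exists i1.
- by exists i2.
by move: par tD; rewrite /misses touchesE; do 3 case: (_ \in D).
Qed.

Lemma touches0 : touches set0 = false.
Proof. by apply/existsP => -[i]; rewrite inE. Qed.

Lemma two_regular0 (H : mgraph) : two_regular (set0 : {set edge H}).
Proof.
apply/forallP => x; rewrite /degree eq_card0 ?eqxx // => f.
by rewrite !inE.
Qed.

Lemma lift_edges_neq0 D s : D != set0 -> lift_edges D s != set0.
Proof. by move=> /set0Pn[f fD]; apply/set0Pn; exists (inl f); rewrite inl_lift. Qed.

Lemma lift_edges_sub D1 D2 s1 s2 :
  (lift_edges D1 s1 \subset lift_edges D2 s2) =
  (D1 \subset D2) && [forall i, (e i \in D1) (+) s1 ==> (e i \in D2) (+) s2].
Proof.
apply/subsetP/andP => [sub|[sub /forallP subi] [f|i]].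
- split; first by apply/subsetP => f; have := sub (inl f); rewrite !inl_lift.
  by apply/forallP => i; have := sub (inr i); rewrite !inr_lift => /implyP.
- by rewrite !inl_lift; apply: (subsetP sub).
by rewrite !inr_lift; apply/implyP.
Qed.

Lemma circuit_set_lift0 s : circuit_set (lift_edges set0 s) = s.
Proof.
apply/idP/idP => [/circuit_set_neq0/set0Pn[[f|i]]|sT].
- by rewrite inl_lift inE.
- by rewrite inr_lift inE.
rewrite sT; apply/minsetP; split.
  rewrite two_regular_lift ?two_regular0 // andbT.
  by apply/set0Pn; exists (inr i0); rewrite inr_lift inE.
move=> X /andP[X0 /two_regular_lifted[D [t [XE rD]]]].
move: X0; rewrite XE lift_edges_sub subset0 => X0 /andP[/eqP D0 _].
move: X0; rewrite D0; case: t {XE} => //.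
by move=> /set0Pn[[f|i]]; rewrite ?inl_lift ?inr_lift inE.
Qed.

(** Inclusions between lifts project to inclusions in [G], so minimality transfers. The exception is
    a [D] that avoids [v] with [s] true: its lift is [D] together with the whole triangle. *)
Lemma circuit_set_lift D s : D != set0 ->
  circuit_set (lift_edges D s) = circuit_set D && (s ==> touches D).
Proof.
move=> D0; apply/idP/andP => [CL|[CD sD]].
  have /minsetP[/andP[_ rL] minL] := CL.
  have rD : two_regular D.
    by have [D1 [s1 [/lift_edges_inj[-> _]]]] := two_regular_lifted rL.
  split.
    apply/minsetP; split; first by rewrite D0.
    move=> B /andP[B0 rB] BD.
    (* If [B] passes through [v], it agrees with [D] there and the same flag works; otherwise the
       flag [false] adds no triangle edge. *)
    have [t tE] : exists t, lift_edges B t \subset lift_edges D s.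
      case tB: (touches B).
        exists s; rewrite lift_edges_sub BD; apply/forallP => i.
        have vB : degree B v != 0.
          by move: tB; rewrite touchesE degree_v; do 3 case: (_ \in B).
        have /setP /(_ (e i)) := two_regular_sub BD rB rD vB.
        rewrite !inE e_inc codom_f !andbT => ->; exact: implybb.
      exists false; rewrite lift_edges_sub BD; apply/forallP => i; rewrite addbF.
      by apply/implyP => eB; case/existsP: (negbT tB); exists i.
    have : lift_edges B t = lift_edges D s.
      by apply: minL; rewrite ?lift_edges_neq0 ?two_regular_lift.
    by case/lift_edges_inj.
  apply/implyP => sT; apply: contraT => nD.
  have : lift_edges D false = lift_edges D s.
    apply: minL; first by rewrite lift_edges_neq0 ?two_regular_lift.
    rewrite lift_edges_sub subxx; apply/forallP => i; rewrite addbF.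
    by apply/implyP => eD; case/existsP: nD; exists i.
  by case/lift_edges_inj; rewrite sT.
have rD := circuit_set_two_regular CD.
apply/minsetP; split; first by rewrite lift_edges_neq0 ?two_regular_lift.
move=> X /andP[X0 /two_regular_lifted[B [t [XE rB]]]]; rewrite {X}XE in X0 *.
rewrite lift_edges_sub => /andP[BD /forallP sub].
have par := two_regular_v rD; have {}sub := (sub i0, sub i1, sub i2).
(* The whole triangle lies in the lift only if [D] uses all three [e i], against parity, or if [s]
   holds and [D] avoids [v], against [sD]. *)
have [B0|B0] := eqVneq B set0.
  have tT : t = true.
    apply: contraT => tF; have /set0Pn[[f|i]] := X0;
    by rewrite ?inl_lift ?inr_lift B0 inE // (negbTE tF).
  move: sub par sD; rewrite tT B0 !inE touchesE.
  by case: (s); do 3 case: (_ \in D) => //=; do ?case=> //.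
have BE : B = D by have /minsetP[_] := CD; apply; rewrite ?B0.
(* The two lifts of [D] are complementary on the triangle, so the smaller would have no triangle
   edge there; parity and [sD] exclude this as before. *)
have [->|ts] := eqVneq t s; first by rewrite BE.
move: sub par ts sD; rewrite BE touchesE.
by case: (s); case: (t) => //; do 3 case: (_ \in D) => //=; do ?case=> //.
Qed.

(** * The two extensions of a double cover *)

Lemma sum_lift (h : {set edge G'} -> nat) :
  (forall X, h X != 0 -> exists D s, X = lift_edges D s) ->
  \sum_(X : {set edge G'}) h X =
  \sum_(D : {set edge G}) (h (lift_edges D true) + h (lift_edges D false)).
Proof.
move=> supp; pose l (p : {set edge G} * bool) := lift_edges p.1 p.2.
have l_inj : injective l by case=> D1 s1 [D2 s2] /lift_edges_inj /= [-> ->].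
have -> : \sum_(X : {set edge G'}) h X = \sum_(X in l @: setT) h X.
  rewrite [RHS]big_mkcond; apply: eq_bigr => X _; case: ifP => // /negP nX.
  apply/eqP/negPn/negP => /supp[D [s XE]]; case: nX.
  by apply/imsetP; exists (D, s); rewrite ?inE.
rewrite big_imset /=; last by move=> ? ? _ _; apply: l_inj.
transitivity (\sum_(D : {set edge G}) \sum_s h (lift_edges D s)).
  rewrite pair_big /=; apply: eq_big => [p|[D s] _] //; by rewrite inE.
by apply: eq_bigr => D _; rewrite big_bool.
Qed.

(** A two-regular [D] that uses [e i] misses exactly one of the other two edges at [v]. The covering
    conditions thus become linear equations in three unknowns. *)
Lemma sum_misses (h : {set edge G} -> nat) (x : 'I_3 -> nat) :
  (forall D, h D != 0 -> two_regular D) ->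
  (forall i, x i = \sum_(D : {set edge G}) misses i D * h D) ->
  [/\ \sum_(D : {set edge G}) (e i0 \in D) * h D = x i1 + x i2,
      \sum_(D : {set edge G}) (e i1 \in D) * h D = x i0 + x i2 &
      \sum_(D : {set edge G}) (e i2 \in D) * h D = x i0 + x i1].
Proof.
move=> supp xE; split; rewrite !xE -big_split; apply: eq_bigr => D _ /=;
  (have [->|/supp /two_regular_v] := eqVneq (h D) 0; first by rewrite !muln0);
  rewrite /misses touchesE; do 3 case: (_ \in D) => //=; lia.
Qed.

(* Here [lift_edges set0 true] is the triangle, and for a circuit D through v,
   [lift_edges D true] and [lift_edges D false] reroute D along one, respectively
   two, edges of the triangle. *)
Definition extend (N : {ffun {set edge G} -> nat}) t : {ffun {set edge G'} -> nat} :=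
  [ffun X => let D := old_edges X in
    if X == lift_edges D true then (if D == set0 then t : nat else (touches D && t) * N D)
    else if X == lift_edges D false then (touches D ==> ~~ t) * N D else 0].

Lemma extend_true N t D :
  extend N t (lift_edges D true) = if D == set0 then t : nat else (touches D && t) * N D.
Proof. by rewrite ffunE /= old_edges_lift eqxx. Qed.

Lemma extend_false N t D : extend N t (lift_edges D false) = (touches D ==> ~~ t) * N D.
Proof.
by rewrite ffunE /= old_edges_lift eqxx; case: eqP => // /lift_edges_inj[].
Qed.

Lemma extend_lifted N t X : extend N t X != 0 -> exists D s, X = lift_edges D s.
Proof.
rewrite ffunE /=; case: (X =P lift_edges (old_edges X) true) => [XE _|_].
  by exists (old_edges X), true.
by case: (X =P lift_edges (old_edges X) false) => // XE _; exists (old_edges X), false.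
Qed.

Lemma extend_double_cover N t : double_cover N -> double_cover (extend N t).
Proof.
move=> cN; have N0 := double_cover0 cN; have [supp sumN] := cN; split.
  move=> X X0; have [D [s XE]] := extend_lifted X0; move: X0; rewrite XE.
  have [->|D0] := eqVneq D set0.
    rewrite circuit_set_lift0; case: s {XE} => //.
    by rewrite extend_false N0 muln0.
  rewrite circuit_set_lift //; case: s {XE}; rewrite ?extend_true ?extend_false.
    by rewrite (negbTE D0); case: (touches D) => //=;
      case: t => //; rewrite mul1n => /supp ->.
  by rewrite muln_eq0 negb_or => /andP[_ /supp ->].
move=> f; rewrite (sum_lift (h := fun X => (f \in X) * extend N t X)); last first.
  by move=> X; rewrite muln_eq0 negb_or => /andP[_ /extend_lifted].
case: f => [f|i].
  rewrite -[RHS](sumN f); apply: eq_bigr => D _.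
  rewrite !inl_lift extend_true extend_false.
  case: eqP => [->|_]; first by rewrite inE.
  by case: (f \in D) => //; case: (touches D); case: t; rewrite /= ?mul1n ?mul0n ?addn0.
have suppr D : N D != 0 -> two_regular D by move=> /supp /circuit_set_two_regular.
pose x i := \sum_(D : {set edge G}) misses i D * N D.
have xE j : x j = \sum_(D : {set edge G}) misses j D * N D by [].
have {suppr} [x0 x1 x2] := sum_misses suppr xE; clearbody x.
(* The unknowns [x i] now sum to 2 in pairs, so each is 1: every pair of edges at [v] is used by
   exactly one circuit of the cover. *)
rewrite !sumN in x0 x1 x2.
(* The edge [inr i] lies on the triangle, on the one-edge reroutings of circuits missing [e i], and
   on the two-edge reroutings of circuits using [e i]. *)
transitivity (t + (t * \sum_(D : {set edge G}) misses i D * N D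
                + ~~ t * \sum_(D : {set edge G}) (e i \in D) * N D)).
  (* The triangle is a lift of the empty set, so its contribution becomes the term at [set0] and the
     sums can be compared termwise. *)
  have tE : (t : nat) = \sum_(D : {set edge G}) (D == set0) * t.
    rewrite (bigD1 set0) //= eqxx big1 ?addn0 ?mul1n // => D /negbTE -> //.
  rewrite [X in _ = X + _]tE !big_distrr -!big_split /=; apply: eq_bigr => D _.
  rewrite !inr_lift extend_true extend_false addbF addbT /misses.
  case: eqP => [->|_]; first by rewrite inE N0 touches0 !muln0 !addn0 mul1n.
  have : e i \in D -> touches D by move=> eD; apply/existsP; exists i.
  case: (e i \in D); case: (touches D); case: (t) => //= tD;
    first [lia | by case: (tD isT)].
rewrite sumN -xE; move: i; apply: ord3P; case: t => //=; lia.
Qed.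

(** The multiplicity of the triangle gives back [t], and the total multiplicity of the two lifts of
    a nonempty [D] gives back [N D]. *)
Lemma extend_inj N1 N2 t1 t2 : double_cover N1 -> double_cover N2 ->
  extend N1 t1 = extend N2 t2 -> N1 = N2 /\ t1 = t2.
Proof.
move=> c1 c2 eqE; have t12 : t1 = t2.
  have := congr1 (fun M : {ffun _ -> _} => M (lift_edges set0 true)) eqE.
  by rewrite !extend_true eqxx; case: (t1); case: (t2).
split=> //; apply/ffunP => D; have [->|/negbTE D0] := eqVneq D set0.
  by rewrite !double_cover0.
have := congr1 (fun M : {ffun _ -> _} =>
  M (lift_edges D true) + M (lift_edges D false)) eqE.
rewrite /= !extend_true !extend_false D0 t12.
by case: (touches D); case: (t2); rewrite /= !mul1n !mul0n ?addn0.
Qed.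

Lemma double_cover_extend N' : double_cover N' ->
  exists N t, double_cover N /\ N' = extend N t.
Proof.
move=> cN'; have [supp sumN'] := cN'.
have lifted X : N' X != 0 -> exists D s, X = lift_edges D s.
  move=> /supp /circuit_set_two_regular /two_regular_lifted[D [s [XE _]]].
  by exists D, s.
have supp2 s D : N' (lift_edges D s) != 0 -> two_regular D.
  move=> /supp /circuit_set_two_regular /two_regular_lifted[D1 [s1]].
  by case=> /lift_edges_inj[-> _].
have sumE f : \sum_(D : {set edge G}) ((f \in lift_edges D true) * N' (lift_edges D true)
                + (f \in lift_edges D false) * N' (lift_edges D false)) = 2.
  rewrite -(sumN' f) (sum_lift (h := fun X => (f \in X) * N' X)) // => X.
  by rewrite muln_eq0 negb_or => /andP[_ /lifted].
have N'0 : N' (lift_edges set0 false) = 0.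
  by apply/eqP/negPn/negP => /supp; rewrite circuit_set_lift0.
have N'untouched D : D != set0 -> ~~ touches D -> N' (lift_edges D true) = 0.
  move=> D0 /negbTE nD; apply/eqP/negPn/negP => /supp.
  by rewrite circuit_set_lift // nD andbF.
pose x s i := \sum_(D : {set edge G}) misses i D * N' (lift_edges D s).
have xP s i : x s i = \sum_(D : {set edge G}) misses i D * N' (lift_edges D s) by [].
have xE s := sum_misses (supp2 s) (xP s); clearbody x.
have e_sum i : \sum_(D : {set edge G}) (e i \in D) * N' (lift_edges D true)
             + \sum_(D : {set edge G}) (e i \in D) * N' (lift_edges D false) = 2.
  rewrite -(sumE (inl (e i))) -big_split; apply: eq_bigr => D _.
  by rewrite !inl_lift.
have tri_sum i : N' (lift_edges set0 true) + x true i
             + \sum_(D : {set edge G}) (e i \in D) * N' (lift_edges D false) = 2.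
  rewrite -(sumE (inr i)) big_split /=; congr (_ + _); last first.
    by apply: eq_bigr => D _; rewrite inr_lift addbF.
  rewrite [RHS](bigD1 set0) //= inr_lift inE mul1n; congr (_ + _).
  rewrite xP (bigD1 set0) //= /misses touches0 mul0n add0n.
  apply: eq_bigr => D D0; rewrite inr_lift addbT.
  (* A nonempty [D] avoiding [v] contains no [e i] but does not count as missing it; its lift with
     the triangle has multiplicity 0, so the terms still agree. *)
  by have [//|/(N'untouched _ D0) ->] := boolP (touches D); rewrite !muln0.
have [t [tE xt]] : exists t : bool, N' (lift_edges set0 true) = t /\
    forall i, x (~~ t) i = 0.
  (* Let m be the multiplicity of the triangle and y_i = [x true i]. The sums at the [e i] give
     [x false i] = 1 - y_i, and those at the triangle edges then give m + y_i = y_j + y_k. So m + 2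
     y_i does not depend on i, all y_i equal m, and m is 0 or 1. *)
  have [a0 a1 a2] := xE true; have [b0 b1 b2] := xE false.
  move: (e_sum i0) (e_sum i1) (e_sum i2) (tri_sum i0) (tri_sum i1) (tri_sum i2).
  rewrite {e_sum tri_sum} a0 a1 a2 b0 b1 b2.
  move: (x) (N' (lift_edges set0 true)) => y m *; exists (m == 1); split.
    by case: eqP; lia.
  by apply: ord3P; case: eqP => /=; lia.
(* Such a two-regular [D] misses some [e i], so its multiplicity is a term of the vanishing sum
   [x (~~ t) i]. *)
have other D : touches D -> N' (lift_edges D (~~ t)) = 0.
  move=> tD; apply/eqP/negPn/negP => ND.
  have [i mi] := touches_misses (supp2 _ _ ND) tD.
  have := xt i; rewrite xP (bigD1 D) //= mi mul1n => /eqP.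
  by rewrite addn_eq0 (negbTE ND).
(* The empty set needs the value 0: the multiplicity of its lift, the triangle, is recorded in [t]
   instead. *)
pose N := [ffun D : {set edge G} =>
  if D == set0 then 0 else N' (lift_edges D true) + N' (lift_edges D false)].
exists N, t; split.
  split.
    move=> D; rewrite ffunE; have [//|D0] := eqVneq D set0.
    rewrite addn_eq0 negb_and => /orP[] /supp; rewrite circuit_set_lift //;
    by move=> /andP[].
  move=> f; rewrite -(sumE (inl f)); apply: eq_bigr => D _.
  rewrite ffunE !inl_lift; case: eqP => [->|_]; first by rewrite inE.
  by rewrite mulnDr.
apply/ffunP => X.
have [XE|X0] := boolP ((N' X != 0) || (extend N t X != 0)); last first.
  by move: X0; rewrite negb_or !negbK => /andP[/eqP -> /eqP ->].
have [D [s {XE}->]] : exists D s, X = lift_edges D s.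
  by case/orP: XE => [/lifted|/extend_lifted].
have NE : N D = if D == set0 then 0 else N' (lift_edges D true) + N' (lift_edges D false).
  by rewrite ffunE.
have [D0|D0] := eqVneq D set0.
  case: s; rewrite ?extend_true ?extend_false D0 ?eqxx ?tE //.
  by rewrite -D0 NE D0 eqxx muln0.
have := N'untouched D D0; have := other D; move: NE; rewrite (negbTE D0) => NE.
case: s; rewrite ?extend_true ?extend_false ?(negbTE D0) NE;
case: (touches D) => /= [/(_ isT) oD _|_ /(_ isT) ->] //; last by rewrite mul1n.
all: by move: oD; case: (t) => /= ->; rewrite ?mul1n ?mul0n ?addn0.
Qed.

Lemma num_double_covers_expand k :
  num_double_covers G k -> num_double_covers G' (k * 2).
Proof.
case=> s [uniq_s size_s sP].
exists [seq extend N t | N <- s, t <- [:: true; false]]; split.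
- apply: allpairs_uniq => // -[N1 t1] [N2 t2].
  move=> /allpairsPdep[M1 [u1 [M1s _ [-> ->]]]] /allpairsPdep[M2 [u2 [M2s _ [-> ->]]]] /=.
  by move=> /extend_inj[]; [apply/sP | apply/sP | move=> -> ->].
- by rewrite size_allpairs size_s.
move=> N'; split.
  by case/allpairsP => -[N t] [/= Ns _ ->]; apply: extend_double_cover; apply/sP.
move=> /double_cover_extend[N [t [/sP Ns ->]]]; apply/allpairsP.
by exists (N, t); split=> //=; case: (t).
Qed.

End Expansion.

(** * Invariance under isomorphism *)

Section Isomorphism.

Variables (G H : mgraph) (phi : vertex G -> vertex H) (psi : edge G -> edge H).
Hypotheses (phi_bij : bijective phi) (psi_bij : bijective psi).
Hypothesis ends_psi : forall f, ends (psi f) = phi @: ends f.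

Let phi_inj := bij_inj phi_bij.
Let psi_inj := bij_inj psi_bij.

Lemma imset_psiK (F : {set edge G}) : psi @^-1: (psi @: F) = F.
Proof. by apply/setP => f; rewrite inE mem_imset. Qed.

Lemma preimset_psiK (F : {set edge H}) : psi @: (psi @^-1: F) = F.
Proof.
have [psi' psiK psi'K] := psi_bij.
apply/setP => f; apply/imsetP/idP => [[g]|fF]; first by rewrite inE => gF ->.
by exists (psi' f); rewrite ?inE psi'K.
Qed.

Lemma two_regular_iso (F : {set edge G}) : two_regular (psi @: F) = two_regular F.
Proof.
have deg x : degree (psi @: F) (phi x) = degree F x.
  rewrite /degree -(card_imset [set f in F | x \in ends f] psi_inj); apply: eq_card => f.
  rewrite inE; apply/andP/imsetP => [[/imsetP[g gF ->]]|[g]].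
    by rewrite ends_psi mem_imset // => xg; exists g; rewrite // inE gF.
  by rewrite inE => /andP[gF xg] ->; rewrite ends_psi !mem_imset.
have [phi' phiK phi'K] := phi_bij.
apply/forallP/forallP => r x; first by rewrite -deg.
by rewrite -[x]phi'K deg.
Qed.

Lemma circuit_set_iso (F : {set edge G}) : circuit_set (psi @: F) = circuit_set F.
Proof.
have nz (B : {set edge G}) :
    (psi @: B != set0) && two_regular (psi @: B) = (B != set0) && two_regular B.
  by rewrite two_regular_iso imset_eq0.
apply/minsetP/minsetP => [[]|[]]; rewrite nz => nF minF; split=> // B.
  rewrite -nz => nB BF; apply: (imset_inj psi_inj).
  by apply: minF => //; apply: imsetS.
rewrite -[B]preimset_psiK nz => nB BF; rewrite (minF _ nB) //.
by have := preimsetS psi BF; rewrite !imset_psiK.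
Qed.

Definition pull (N : {ffun {set edge H} -> nat}) : {ffun {set edge G} -> nat} :=
  [ffun F : {set edge G} => N (psi @: F)].

Definition push (N : {ffun {set edge G} -> nat}) : {ffun {set edge H} -> nat} :=
  [ffun F : {set edge H} => N (psi @^-1: F)].

Lemma pushK : cancel push pull.
Proof. by move=> N; apply/ffunP => F; rewrite !ffunE imset_psiK. Qed.

Lemma pullK : cancel pull push.
Proof. by move=> N; apply/ffunP => F; rewrite !ffunE preimset_psiK. Qed.

Lemma double_cover_push N : double_cover (push N) <-> double_cover N.
Proof.
have sumE f : \sum_(F : {set edge H}) (psi f \in F) * push N F =
              \sum_(F : {set edge G}) (f \in F) * N F.
  rewrite (reindex (fun F : {set edge G} => psi @: F)) /=; last first.
    by exists (fun F : {set edge H} => psi @^-1: F) => F _;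
      rewrite ?imset_psiK ?preimset_psiK.
  by apply: eq_bigr => F _; rewrite ffunE imset_psiK mem_imset.
have [psi' psiK psi'K] := psi_bij.
split=> -[supp sumN]; split.
- by move=> F NF; rewrite -circuit_set_iso; apply: supp; rewrite ffunE imset_psiK.
- by move=> f; rewrite -sumE.
- by move=> F; rewrite ffunE => /supp; rewrite -circuit_set_iso preimset_psiK.
by move=> f; rewrite -[f]psi'K sumE.
Qed.

Lemma num_double_covers_bij k : num_double_covers G k -> num_double_covers H k.
Proof.
case=> s [uniq_s size_s sP]; exists (map push s); split.
- by rewrite map_inj_uniq //; apply: can_inj pushK.
- by rewrite size_map.
move=> N; rewrite -[N]pullK double_cover_push -sP mem_map //.
exact: can_inj pushK.
Qed.

End Isomorphism.

Lemma num_double_covers_iso G H k :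
  isomorphic G H -> num_double_covers G k -> num_double_covers H k.
Proof.
by case=> phi [psi [phi_bij psi_bij ends_psi]]; apply: num_double_covers_bij ends_psi k.
Qed.

(** * The two-vertex graph with three parallel edges *)

Section Theta.

(** Every edge contains both vertices, so each degree is the number of edges of [F]. *)
Lemma circuit_set_theta (F : {set edge theta}) : circuit_set F = (#|F| == 2).
Proof.
have rE (B : {set edge theta}) : two_regular B = (#|B| == 0) || (#|B| == 2).
  have deg x : @degree theta B x = #|B|.
    by apply: eq_card => f; rewrite !inE andbT.
  apply/forallP/idP => [/(_ ord0)|cB x]; by rewrite deg.
have nz (B : {set edge theta}) : (B != set0) && two_regular B = (#|B| == 2).
  by rewrite rE -cards_eq0; case: #|B| => [|[|[]]].
apply/minsetP/eqP => [[]|cF]; rewrite nz; first by move/eqP.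
split; first exact/eqP.
by move=> B; rewrite nz => /eqP cB BF; apply/eqP; rewrite eqEcard BF cF cB.
Qed.

(** The three circuits are the complements of single edges. Each edge lies on two of them, so their
    multiplicities sum to 2 in pairs, and all are 1. *)
Lemma num_double_covers_theta : num_double_covers theta 1.
Proof.
pose N0 : {ffun {set edge theta} -> nat} :=
  [ffun F : {set edge theta} => #|F| == 2 : nat].
exists [:: N0]; split=> // N; rewrite inE.
pose c (j : 'I_3) : {set edge theta} := [set~ j].
have cardc j : #|c j| = 2 by rewrite cardsC1 card_ord.
have c_inj : injective c by move=> i j /setC_inj /set1_inj.
have cP (F : {set edge theta}) : #|F| = 2 -> exists j, F = c j.
  move=> cF; have /cards1P[j jF] : #|~: F| == 1.
    by have := cardsC F; rewrite card_ord cF => /eqP; rewrite (eqn_add2l 2 _ 1).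
  by exists j; rewrite /c -jF setCK.
have sumE (M : {ffun {set edge theta} -> nat}) f :
    (forall F, M F != 0 -> circuit_set F) ->
    \sum_(F : {set edge theta}) (f \in F) * M F = \sum_(j < 3) (f != j) * M (c j).
  move=> supp; transitivity (\sum_(F in c @: setT) (f \in F) * M F).
    rewrite [RHS]big_mkcond; apply: eq_bigr => F _; case: ifP => // /negP nF.
    apply/eqP; rewrite muln_eq0; apply/orP; right; apply/negPn/negP => /supp.
    rewrite circuit_set_theta => /eqP /cP[j FE]; case: nF; rewrite FE.
    exact: imset_f.
  rewrite big_imset; last by move=> ? ? _ _; apply: c_inj.
  by apply: eq_big => [j|j _]; rewrite !inE.
split=> [/eqP ->|[supp sumN]].
  have supp F : N0 F != 0 -> circuit_set F.
    by rewrite circuit_set_theta ffunE; case: (#|F| == 2).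
  split=> // f; rewrite sumE // (eq_bigr (fun j => (f != j : nat))); last first.
    by move=> j _; rewrite ffunE cardc muln1.
  by rewrite sum_ord3; move: f; apply: ord3P.
have N1 j : N (c j) = 1.
  have sum3 f := etrans (esym (sumE N f supp)) (sumN f).
  move: (sum3 (@Ordinal 3 0 isT)) (sum3 (@Ordinal 3 1 isT)) (sum3 (@Ordinal 3 2 isT)).
  rewrite !sum_ord3 /=; move: j; apply: ord3P; rewrite ?mul0n ?mul1n ?addn0 ?add0n; lia.
apply/eqP/ffunP => F; rewrite ffunE; case: eqP => [/cP[j ->]|cF]; first by rewrite N1.
apply/eqP/negPn/negP => /supp; rewrite circuit_set_theta; exact/negP/eqP.
Qed.

End Theta.

(** * From multiplicity functions back to multisets of circuits *)

Section Multisets.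

Variable G : mgraph.

Lemma circuit_edges_inj : injective (@circuit_edges G).
Proof.
move=> [[V F] C1] [[W D] C2] /= FD; apply: val_inj => /=.
have := circuit_covered C1; have := circuit_covered C2.
by rewrite /circuit_edges /= in FD *; rewrite FD => -> ->.
Qed.

Lemma circuit_edges_set (C : circuit G) : circuit_set (circuit_edges C).
Proof. by case: C => S SC; apply: circuit_edge_set. Qed.

Lemma circuit_setP (F : {set edge G}) :
  circuit_set F -> exists C : circuit G, circuit_edges C = F.
Proof. by move=> /circuit_set_circuit FC; exists (Sub _ FC). Qed.

Definition mset_of (N : {ffun {set edge G} -> nat}) : {mset circuit G} :=
  [fsfun C in [fset C | C in circuit G]%fset => N (circuit_edges C)].

Lemma mset_ofE N C : mset_of N C = N (circuit_edges C).
Proof. by rewrite fsfunE; case: ifP => // /negbT; rewrite in_fset inE. Qed.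

Lemma sum_circuit_edges (h : {set edge G} -> nat) :
  (forall F, h F != 0 -> circuit_set F) ->
  \sum_F h F = \sum_(C : circuit G) h (circuit_edges C).
Proof.
move=> supp.
have -> : \sum_F h F = \sum_(F in [set circuit_edges C | C : circuit G]) h F.
  rewrite [RHS]big_mkcond; apply: eq_bigr => F _; case: ifP => // /negP nF.
  apply/eqP/negPn/negP => /supp /circuit_setP[C CF]; case: nF.
  by apply/imsetP; exists C.
by rewrite big_imset //= => ? ? _ _; apply: circuit_edges_inj.
Qed.

Lemma mset_of_cover (N : {ffun {set edge G} -> nat}) :
  (forall F, N F != 0 -> circuit_set F) ->
  is_circuit_double_cover (mset_of N) <-> double_cover N.
Proof.
move=> supp; have sumE f : \sum_(C : circuit G | f \in circuit_edges C) mset_of N C =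
    \sum_(F : {set edge G}) (f \in F) * N F.
  rewrite big_mkcond (sum_circuit_edges (h := fun F => (f \in F) * N F)); last first.
    by move=> F; rewrite muln_eq0 negb_or => /andP[_ /supp].
  by apply: eq_bigr => C _; rewrite mset_ofE; case: ifP => _; rewrite ?mul1n.
by split=> [cM|[_ cN]]; [split=> // f|move=> f]; rewrite -?sumE // sumE.
Qed.

Lemma mset_of_surj M : exists N : {ffun {set edge G} -> nat},
  (forall F, N F != 0 -> circuit_set F) /\ M = mset_of N.
Proof.
(* By [circuit_edges_inj] the sum has at most one term, and none if [F] is not the edge set of a
   circuit; no inverse of [circuit_edges] has to be chosen. *)
exists [ffun F : {set edge G} => \sum_(C : circuit G | circuit_edges C == F) M C]; split.
  move=> F; rewrite ffunE; apply: contraNT => nF; rewrite big1 // => C /eqP CF.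
  by case/negP: nF; rewrite -CF circuit_edges_set.
apply/msetP => C; rewrite mset_ofE ffunE (big_pred1 C) // => C'.
by rewrite (inj_eq circuit_edges_inj).
Qed.

Lemma mset_of_inj N1 N2 : double_cover N1 -> double_cover N2 ->
  mset_of N1 = mset_of N2 -> N1 = N2.
Proof.
move=> [supp1 _] [supp2 _] eqM; apply/ffunP => F.
have [/circuit_setP[C <-]|nF] := boolP (circuit_set F).
  by rewrite -!mset_ofE eqM.
have -> : N1 F = 0 by apply/eqP/negPn; apply: contra nF; apply: supp1.
by apply/esym/eqP/negPn; apply: contra nF; apply: supp2.
Qed.

Lemma num_double_covers_mset k : num_double_covers G k ->
  exists S : {fset {mset circuit G}},
    #|` S|%fset = k /\ forall M, M \in S <-> is_circuit_double_cover M.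
Proof.
case=> s [uniq_s size_s sP]; exists [fset M in map mset_of s]%fset; split.
  rewrite card_fseq undup_id ?size_map // map_inj_in_uniq // => N1 N2 /sP c1 /sP c2.
  exact: mset_of_inj.
move=> M; rewrite in_fset; split.
  by case/mapP => N /sP cN ->; apply/mset_of_cover; case: cN.
have [N [supp ->]] := mset_of_surj M.
by move=> /(mset_of_cover supp) /sP Ns; apply: map_f.
Qed.

End Multisets.

(** * The count, by induction on the expansions *)

(** The bound on the number of vertices is carried along because of truncated subtraction: below 2
    vertices, adding two vertices would not raise the exponent by one. *)
Lemma theta_expansion_count G : theta_expansion G ->
  2 <= #|vertex G| /\ num_double_covers G (2 ^ (#|vertex G|./2 - 1)).
Proof.
elim=> {G} [|G v e e_inj e_inc _ [n2 IH]|G H GH _ [n2 IH]].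
- by rewrite card_ord; split=> //; apply: num_double_covers_theta.
- have -> : #|vertex (expand e_inj e_inc)| = #|vertex G|.+2.
    rewrite card_sum card_sig card_ord.
    rewrite (_ : #|[pred x | x != v]| = #|vertex G|.-1) ?cardC1 //.
    by case: #|_| n2 => // m _; rewrite addn3.
  split=> //.
  have -> : #|vertex G|.+2./2 - 1 = (#|vertex G|./2 - 1).+1 by lia.
  by rewrite expnSr; apply: num_double_covers_expand.
have <- : #|vertex G| = #|vertex H|.
  by case: GH => phi [psi [/bij_eq_card]].
by split=> //; apply: num_double_covers_iso GH IH.
Qed.

From mathcomp Require Import classical_sets cardinality.

Local Open Scope mset_scope.
Local Open Scope classical_set_scope.
Local Open Scope card_scope.

Theorem corollary28 (G : mgraph) (n : nat)
    (hG : theta_expansion G) (hn : #|vertex G| = n) :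
  [set M : {mset circuit G} | is_circuit_double_cover M]
    #= `I_(2 ^ (n./2 - 1))%N.
Proof.
have [_ /num_double_covers_mset[S [cardS SP]]] := theta_expansion_count hG.
rewrite -hn -cardS (_ : [set M | _] = [set` S]) //; first exact/card_eq_fsetP.
by apply/seteqP; split=> M /SP.
Qed.
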